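(* For each real number $\varepsilon > 0$ there exists $c \in \mathbb{Z}$ such that every simple triangle-free binary matroid $M$ with $|M| \ge \left(\tfrac{1}{4} + \varepsilon\right)2^{r(M)}$ satisfies $\chi(M) \le c$.
   Context: Matroids are finite. For a matroid $M$, $E(M)$ is its ground set, $|M| = |E(M)|$, and $r(M)$ is its rank. A simple binary matroid of rank $r$ is viewed as a restriction of the projective geometry $G \cong \mathrm{PG}(r-1,2)$ (equivalently, as a set of nonzero vectors in $\mathrm{GF}(2)^r$). The critical number $\chi(M)$ is the minimum nonnegative integer $c$ such that $G$ has a rank-$(r-c)$ flat disjoint from $E(M)$; equivalently, the minimum codimension of a subspace of $\mathrm{GF}(2)^r$ containing no element of $E(M)$. A matroid is triangle-free if it has no restriction isomorphic to $U_{2,3}$ (for a simple binary matroid represented by a set $X$ of nonzero vectors: no three distinct elements of $X$ sum to zero). *)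

(* Defs.v *)
From HB Require Import structures.
From mathcomp Require Import all_boot all_order all_algebra.

Set Implicit Arguments.
Unset Strict Implicit.
Unset Printing Implicit Defensive.

Import GRing.Theory.

Record matroid := Matroid {
  ground :> finType;
  indep : pred {set ground};
  indep_set0 : indep set0;
  indep_sub : forall I J : {set ground}, I \subset J -> indep J -> indep I;
  indep_augment : forall I J : {set ground}, indep I -> indep J ->
    #|I| < #|J| -> exists2 x, x \in J :\: I & indep (x |: I) }.

Arguments indep : clear implicits.

Definition rank_of (M : matroid) (A : {set M}) : nat :=
  \max_(I : {set M} | indep M I && (I \subset A)) #|I|.

Definition rank (M : matroid) : nat := rank_of [set: M].

Definition flat (M : matroid) (F : {set M}) : bool :=
  [forall x, (x \notin F) ==> (rank_of F < rank_of (x |: F))].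

(* No loops and no parallel pairs. *)
Definition simple (M : matroid) : bool :=
  [forall A : {set M}, (#|A| <= 2) ==> indep M A].

(* [f] is an isomorphism from [M] onto the restriction of [N] to the image
   of [f]. *)
Definition embedding (M N : matroid) (f : {ffun M -> N}) : bool :=
  injectiveb f && [forall A : {set M}, indep N (f @: A) == indep M A].

Definition has_restriction (M N : matroid) : Prop :=
  exists f : {ffun N -> M}, embedding f.

Section Uniform.
Variables k n : nat.

Definition uniform_indep : pred {set 'I_n} := fun A => #|A| <= k.

Fact uniform_set0 : uniform_indep set0.
Proof. by rewrite /uniform_indep cards0. Qed.

Fact uniform_sub (I J : {set 'I_n}) :
  I \subset J -> uniform_indep J -> uniform_indep I.
Proof. by move=> /subset_leq_card; apply: leq_trans. Qed.

Fact uniform_augment (I J : {set 'I_n}) :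
  uniform_indep I -> uniform_indep J -> #|I| < #|J| ->
  exists2 x, x \in J :\: I & uniform_indep (x |: I).
Proof.
move=> _ Jk ltIJ; have /subsetPn[x Jx I'x] : ~~ (J \subset I).
  by apply: contraL ltIJ => /subset_leq_card; rewrite -leqNgt.
exists x; first by rewrite inE I'x.
by rewrite /uniform_indep cardsU1 I'x (leq_trans ltIJ).
Qed.

Definition uniform := Matroid uniform_set0 uniform_sub uniform_augment.
End Uniform.

Definition triangle_free (M : matroid) : Prop :=
  ~ has_restriction M (uniform 2 3).

(* The vector matroid of the family [phi]. [image phi A] keeps repetitions, so
   [free] tests linear independence of the subfamily indexed by [A]. *)
Section VectorMatroid.
Variables (K : fieldType) (vT : vectType K) (T : finType) (phi : T -> vT).

Definition vector_indep : pred {set T} := fun A => free [seq phi x | x in A].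

Fact vector_set0 : vector_indep set0.
Proof. by rewrite /vector_indep /image_mem enum_set0 nil_free. Qed.

Fact vector_sub (I J : {set T}) :
  I \subset J -> vector_indep J -> vector_indep I.
Proof.
move=> sIJ frJ; have /dinjectiveP injJ := free_uniq frJ.
have uI : uniq [seq phi x | x in I].
  by apply/dinjectiveP=> x y Ix Iy; apply: injJ; apply: (subsetP sIJ).
have sub v : v \in [seq phi x | x in I] -> v \in [seq phi x | x in J].
  by case/imageP=> x Ix ->; apply/image_f/(subsetP sIJ).
rewrite /vector_indep (perm_free (Y := [seq v <- [seq phi x | x in J] |
                                         v \in [seq phi x | x in I]])).
  exact: filter_free.
apply: uniq_perm; rewrite ?uI ?filter_uniq ?free_uniq // => v.
by rewrite mem_filter andb_idr //; apply: sub.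
Qed.

Fact vector_augment (I J : {set T}) :
  vector_indep I -> vector_indep J -> #|I| < #|J| ->
  exists2 x, x \in J :\: I & vector_indep (x |: I).
Proof.
move=> frI frJ ltIJ; pose U := <<[seq phi x | x in I]>>%VS.
have [x Jx U'x] : exists2 x, x \in J & phi x \notin U.
  apply/exists_inP; apply: contraLR ltIJ.
  rewrite negb_exists_in -leqNgt => /forall_inP sJU.
  move: frI frJ; rewrite /vector_indep /free !size_map -!cardE.
  move=> /eqP <- /eqP <-; apply/dimvS/span_subvP => _ /imageP[x Jx ->].
  by have := sJU x Jx; rewrite negbK.
have I'x : x \notin I.
  by apply: contra U'x => Ix; apply: memv_span; apply: image_f.
exists x; first by rewrite inE I'x.
rewrite /vector_indep (@perm_free _ _ _ (phi x :: [seq phi y | y in I])).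
  by rewrite free_cons U'x.
rewrite -[_ :: _]/(map phi (x :: enum I)); apply: perm_map.
apply: uniq_perm; rewrite /= ?enum_uniq ?mem_enum ?I'x // => y.
by rewrite !inE !mem_enum !inE.
Qed.

Definition vector_matroid := Matroid vector_set0 vector_sub vector_augment.
End VectorMatroid.

Definition binary (M : matroid) : Prop :=
  exists (n : nat) (phi : M -> 'rV['F_2]_n),
    forall A : {set M}, indep M A = indep (vector_matroid phi) A.

(* [PG r] is PG(r-1, 2): nonzero vectors and points coincide over GF(2). *)
Definition PG (r : nat) : matroid :=
  vector_matroid (val : {v : 'rV['F_2]_r | v != 0%R} -> 'rV['F_2]_r).

(* A simple binary [M] embeds in PG(r(M)-1, 2), and any two embeddings differ
   by a linear automorphism, so the choice of [f] is immaterial. *)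
Definition has_disjoint_flat (M : matroid) (c : nat) : bool :=
  [exists f : {ffun M -> PG (rank M)}, embedding f &&
    [exists F : {set PG (rank M)},
      [&& flat F, rank_of F + c == rank M & [disjoint F & f @: [set: M]]]]].

(* For simple binary [M], [c = rank M] is always admissible (take the empty
   flat), so the minimum may be sought among [c <= rank M]. *)
Definition critical_number (M : matroid) : nat :=
  [arg min_(c < ord_max : 'I_(rank M).+1 | has_disjoint_flat M c) c].

(* Main.v *)
(* Embed [M] as a set [A] of nonzero vectors of V = GF(2)^r, [N = 2^r], and let
   [H] be the annihilator of the characters [g] whose Fourier coefficient
   [hat A g] is below [- eps N / 2]. By Parseval there are at most [4 / eps^2]
   of them, so [H] has bounded codimension, and it suffices that [H] misses [A].
   Since [A] is sum-free, the cubes of all Fourier coefficients add up to 0, so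
   those of the characters trivial on [H] have a small sum: few triples of [A]
   have their sum in [H]. But if [a] lies in [A] and in [H], then [A] and its
   translate by [a] are disjoint, so [A] fills at most half of each coset of
   [H]. Doubling the density of [A] on cosets thus gives a function f <= 1 of
   mean at least 1/2 + 2 eps; since f(v) f(x + v) >= f(v) + f(x + v) - 1, each
   product f(v) f(x + v) has mean at least 4 eps over v, which yields too many
   triples with sum in [H]. *)
From HB Require Import structures.
Require Import Defs.
From mathcomp Require Import all_boot all_order all_algebra.
From mathcomp Require Import reals ring lra.

Set Implicit Arguments.
Unset Strict Implicit.
Unset Printing Implicit Defensive.

Import Order.TTheory GRing.Theory Num.Theory.
Local Open Scope ring_scope.

(** * Fourier analysis on GF(2)^r *)

Section BinaryFourier.
Variables (R : realFieldType) (r : nat).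
Implicit Types (g x y z v : 'rV['F_2]_r) (A : {set 'rV['F_2]_r}).

Lemma opp_rowF2 v : - v = v.
Proof. by apply/rowP=> i; rewrite mxE (oppr_pchar2 (pchar_Fp _)). Qed.

Lemma addvv_rowF2 v : v + v = 0.
Proof. by rewrite -{2}(opp_rowF2 v) subrr. Qed.

Lemma addvvDK_rowF2 v u : v + (v + u) + u = 0.
Proof. by rewrite addrA addvv_rowF2 add0r addvv_rowF2. Qed.

Lemma card_rowF2 : (#|{: 'rV['F_2]_r}|)%:R = 2 ^+ r :> R.
Proof. by rewrite card_mx mul1n card_Fp // natrX. Qed.

Lemma sum_const_rowF2 (c : R) : \sum_(v : 'rV['F_2]_r) c = c * 2 ^+ r.
Proof. by rewrite sumr_const -[LHS]mulr_natr -card_rowF2. Qed.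

Definition signF2 (a : 'F_2) : R := if a == 0 then 1 else -1.

Lemma signF2D (a b : 'F_2) : signF2 (a + b) = signF2 a * signF2 b.
Proof.
by case: a b => [[|[|a]] //= ?] [[|[|b]] //= ?];
  rewrite /signF2 -!val_eqE /= ?mulr1 ?mul1r ?mulrNN ?mulr1.
Qed.

Definition chi g v : R := signF2 ((g *m v^T) 0 0).

Lemma chiDl g g' v : chi (g + g') v = chi g v * chi g' v.
Proof. by rewrite /chi mulmxDl mxE signF2D. Qed.

Lemma chiDr g v v' : chi g (v + v') = chi g v * chi g v'.
Proof. by rewrite /chi linearD mulmxDr mxE signF2D. Qed.

Lemma chiC g v : chi g v = chi v g.
Proof. by rewrite /chi -[in LHS](trmxK g) -trmx_mul mxE. Qed.

(** Orthogonality: the row space of [B] is a group of characters, and [v *m B^T == 0] says that [v]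
    lies in its annihilator. Otherwise some row has character value -1 at [v], and translating by
    that row negates the sum. *)
Lemma sum_chi k (B : 'M['F_2]_(k, r)) v :
  \sum_(g | (g <= B)%MS) chi g v =
  (v *m B^T == 0)%:R * #|[pred g : 'rV['F_2]_r | (g <= B)%MS]|%:R.
Proof.
case: eqP => [vB0|/eqP vB].
  rewrite mul1r -sum1_card natr_sum; apply: eq_bigr => g /submxP[u ->].
  have Bv0 : B *m v^T = 0 by rewrite -[B]trmxK -trmx_mul vB0 trmx0.
  by rewrite /chi -mulmxA Bv0 mulmx0 mxE /signF2 eqxx.
rewrite mul0r.
have [i vBi] : exists i, (v *m B^T) 0 i != 0.
  apply/existsP; apply: contraR vB; rewrite negb_exists => /forallP vB0.
  by apply/eqP/rowP=> i; rewrite [RHS]mxE; apply/eqP; rewrite -[_ == _]negbK.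
have chi_i : chi (row i B) v = -1.
  rewrite chiC /chi /signF2 tr_row colE mulmxA -colE mxE.
  by rewrite (negPf vBi).
set s := \sum_(g | _) _; have : s = - s.
  rewrite {1}/s (reindex_inj (addrI (row i B))) /= -sumrN.
  apply: eq_big => [g|g _]; last by rewrite chiDl chi_i mulN1r.
  apply/idP/idP=> [|gB]; last by rewrite addmx_sub ?row_sub.
  by move=> h; rewrite -[g](addKr (row i B)) addmx_sub // opp_rowF2 row_sub.
by move=> ?; lra.
Qed.

Lemma sum_chi_full v : \sum_g chi g v = (v == 0)%:R * 2 ^+ r.
Proof.
rewrite -card_rowF2 (eq_bigl (fun g => (g <= (1%:M : 'M_r))%MS)) => [|g].
  rewrite sum_chi trmx1 mulmx1; congr (_ * _%:R).
  by apply: eq_card => g; rewrite !inE submx1.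
by rewrite submx1.
Qed.

Definition hat A g : R := \sum_(x in A) chi g x.

(** Expanding the square leads to sums of [chi g (x + y)] over all [g], and only the pairs with
    [x = y] survive. *)
Lemma hat_parseval A : \sum_g hat A g ^+ 2 = 2 ^+ r * #|A|%:R.
Proof.
under eq_bigr => g _ do rewrite expr2 /hat big_distrlr /=.
rewrite exchange_big /= -sum1_card natr_sum mulr_sumr; apply: eq_bigr => x Ax.
rewrite exchange_big /= (bigD1 x) //= [X in _ + X]big1 => [|y /andP[_ yx]].
  under eq_bigr => g _ do rewrite -chiDr.
  by rewrite sum_chi_full -{2}(opp_rowF2 x) subrr eqxx mul1r addr0 mulr1.
under eq_bigr => g _ do rewrite -chiDr.
by rewrite sum_chi_full -(opp_rowF2 y) subr_eq0 eq_sym (negPf yx) mul0r.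
Qed.

Lemma hat_cube A g :
  hat A g ^+ 3 = \sum_(x in A) \sum_(y in A) \sum_(z in A) chi g (x + y + z).
Proof.
rewrite exprSr expr2 /hat big_distrlr /= mulr_suml; apply: eq_bigr => x _.
rewrite mulr_suml; apply: eq_bigr => y _; rewrite mulr_sumr.
by apply: eq_bigr => z _; rewrite !chiDr.
Qed.

(** Orthogonality turns cubes into a count of triples of [A] with sum in the annihilator of [B]; for
    the identity matrix these are the triples of sum 0. *)
Lemma sum_hat_cube A k (B : 'M['F_2]_(k, r)) :
  \sum_(g | (g <= B)%MS) hat A g ^+ 3 =
  #|[pred g : 'rV['F_2]_r | (g <= B)%MS]|%:R *
  \sum_(x in A) \sum_(y in A) \sum_(z in A) ((x + y + z) *m B^T == 0)%:R.
Proof.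
under eq_bigr => g _ do rewrite hat_cube.
rewrite exchange_big mulr_sumr; apply: eq_bigr => x _.
rewrite exchange_big mulr_sumr; apply: eq_bigr => y _.
rewrite exchange_big mulr_sumr; apply: eq_bigr => z _.
by rewrite sum_chi mulrC.
Qed.

(** Double counting of [chi g v] over all [v] and all [g] in the row space: summing over [v] first
    leaves only [g = 0]. *)
Lemma card_annihilator k (B : 'M['F_2]_(k, r)) :
  #|[pred g : 'rV['F_2]_r | (g <= B)%MS]|%:R *
  \sum_(v : 'rV['F_2]_r) (v *m B^T == 0)%:R = 2 ^+ r :> R.
Proof.
transitivity (\sum_v \sum_(g : 'rV['F_2]_r | (g <= B)%MS) chi g v).
  by rewrite mulr_sumr; apply: eq_bigr => v _; rewrite sum_chi mulrC.
rewrite exchange_big (bigD1 0) ?sub0mx //= [X in _ + X]big1 => [|g /andP[_ g0]];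
  under eq_bigr => v _ do rewrite chiC; rewrite sum_chi_full.
  by rewrite eqxx mul1r addr0.
by rewrite (negPf g0) mul0r.
Qed.

(** Up to scaling this is (1 - f)(1 - f') >= 0 with f = 2a/h and f' = 2b/h. *)
Lemma half_prod_ge (a b h : R) : 2 * a <= h -> 2 * b <= h ->
  h / 2 * (a + b - h / 2) <= a * b.
Proof.
move=> ah bh; rewrite -subr_ge0.
rewrite (_ : _ - _ = (h / 2 - a) * (h / 2 - b)); last by field.
by apply: mulr_ge0; lra.
Qed.

(* [half_prod_ge] is applied with [h = |H|], [a] and [b] being the numbers of
   points of [A] in two cosets of [H]. *)
Lemma sum_coset_pairs A k (B : 'M['F_2]_(k, r)) :
  let K (v : 'rV['F_2]_r) : R := (v *m B^T == 0)%:R in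
  let h := \sum_(v : 'rV['F_2]_r) K v in
  (forall v, 2 * \sum_(z in A) K (v + z) <= h) ->
  h * #|A|%:R * (#|A|%:R - 2 ^+ r / 4) <=
  \sum_(x in A) \sum_(y in A) \sum_(z in A) K (x + y + z).
Proof.
move=> K h; pose F (v : 'rV['F_2]_r) := \sum_(z in A) K (v + z).
rewrite -/F => Fh.
have KD (u v : 'rV['F_2]_r) : K v = 1 -> K (u + v) = K u.
  rewrite /K mulmxDl; case: eqP => [->|_ /eqP]; first by rewrite addr0.
  by rewrite eq_sym oner_eq0.
have h_gt0 : 0 < h.
  rewrite /h (bigD1 0) //= {1}/K mul0mx eqxx ltr_wpDr //.
  by apply: sumr_ge0 => v _; rewrite ler0n.
have sumK (u : 'rV['F_2]_r) : \sum_(v : 'rV['F_2]_r) K (u + v) = h.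
  by rewrite [RHS](reindex_inj (addrI u)).
have sumF (u : 'rV['F_2]_r) : \sum_(v : 'rV['F_2]_r) F (u + v) = h * #|A|%:R.
  rewrite /F exchange_big -sum1_card natr_sum mulr_sumr; apply: eq_bigr => z _.
  by rewrite mulr1 -(sumK (u + z)); apply: eq_bigr => v _; rewrite addrAC.
have -> : h * #|A|%:R * (#|A|%:R - 2 ^+ r / 4) =
    \sum_(x in A) h * (#|A|%:R - 2 ^+ r / 4).
  by rewrite sumr_const -mulr_natl; ring.
apply: ler_sum => x _.
rewrite -[leRHS]/(\sum_(y in A) F (x + y)).
(* [F] is constant on cosets of H: if [v + y] lies in H then [F (x + v) = F (x + y)], and each [y]
   has [h] such [v]. *)
have dbl : \sum_(v : 'rV['F_2]_r) F (x + v) * F v = h * \sum_(y in A) F (x + y).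
  rewrite mulr_sumr.
  transitivity (\sum_(v : 'rV['F_2]_r) \sum_(y in A) F (x + v) * K (v + y)).
    by apply: eq_bigr => v _; rewrite mulr_sumr.
  rewrite exchange_big; apply: eq_bigr => y _ /=.
  rewrite -(sumK y) mulr_suml; apply: eq_bigr => v _.
  rewrite [y + v]addrC /K; case: eqP => [vy0|]; last by rewrite mulr0 mul0r.
  rewrite mulr1 mul1r /F; apply: eq_bigr => z _.
  have -> : x + v + z = x + y + z + (v + y).
    by rewrite [x + y + z]addrAC addrACA -{2}(opp_rowF2 y) subrr addr0 addrAC.
  by apply: KD; rewrite /K vy0 eqxx.
rewrite -(ler_pM2l h_gt0) -dbl.
have lb (v : 'rV['F_2]_r) :
    h / 2 * (F (x + v) + F v - h / 2) <= F (x + v) * F v.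
  exact: half_prod_ge (Fh _) (Fh _).
apply: le_trans (ler_sum _ (fun v _ => lb v)).
have sumF0 : \sum_(v : 'rV['F_2]_r) F v = h * #|A|%:R.
  by rewrite -(sumF 0); apply: eq_bigr => v _; rewrite add0r.
rewrite -mulr_sumr sumrB big_split /= sumF sumF0 sum_const_rowF2.
have le_avg (h' a N : R) :
    h' * (h' * (a - N / 4)) <= h' / 2 * (h' * a + h' * a - h' / 2 * N).
  by rewrite le_eqVlt; apply/orP; left; apply/eqP; field.
exact: le_avg.
Qed.

End BinaryFourier.

(** * Large subspaces that miss a dense sum-free set *)

Lemma sum_free_large_subspace (R : realType) (eps : R) (r : nat)
    (A : {set 'rV['F_2]_r}) :
  0 < eps ->
  {in A & &, forall x y z : 'rV['F_2]_r, x + y + z != 0} ->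
  (4^-1 + eps) * 2 ^+ r <= #|A|%:R ->
  exists2 U : {vspace 'rV['F_2]_r},
    (r <= \dim U + Num.bound (4 / eps ^+ 2))%N & {in A, forall a, a \notin U}.
Proof.
move=> e_gt0 sfA dA; set N : R := 2 ^+ r in dA *.
have N_gt0 : 0 < N by rewrite exprn_gt0.
have A_gt0 : 0 < #|A|%:R :> R.
  by apply: lt_le_trans dA; rewrite mulr_gt0 //; lra.
(* The factor 1/2 makes the final upper bound on triples half of the lower bound. *)
pose S := [set g | hat R A g < - (eps / 2 * N)].
(* By Parseval the squares sum to [N] times the size of [A], hence to at most N^2, while each member
   of [S] contributes at least (eps N / 2)^2. *)
have leS : #|S|%:R <= 4 / eps ^+ 2.
  rewrite ler_pdivlMr ?exprn_gt0 //.
  have : #|S|%:R * (eps / 2 * N) ^+ 2 <= N * #|A|%:R.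
    rewrite -hat_parseval -sum1_card natr_sum mulr_suml.
    rewrite [leRHS](bigID (mem S)) /= -[leLHS]addr0 lerD //; last first.
      by apply: sumr_ge0 => g _; apply: sqr_ge0.
    apply: ler_sum => g; rewrite inE mul1r => Sg.
    have : 0 < eps / 2 * N by rewrite mulr_gt0 //; lra.
    move: (eps / 2 * N) Sg => t *.
    by rewrite -[leRHS]sqrrN ler_sqr ?nnegrE; lra.
  have AN : #|A|%:R <= N by rewrite /N -card_rowF2 ler_nat max_card.
  have := ler_wpM2l (ltW N_gt0) AN => ??.
  rewrite -(ler_pM2r (exprn_gt0 2 N_gt0)).
  have -> : #|S|%:R * eps ^+ 2 * N ^+ 2 = 4 * (#|S|%:R * (eps / 2 * N) ^+ 2).
    by field.
  by rewrite ler_pM2l // expr2; lra.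
(* The rows of [B] list [S], so [U] is the annihilator of [S]; rank-nullity bounds its codimension
   by the size of [S]. *)
pose B : 'M['F_2]_(#|S|, r) := \matrix_i enum_val i.
pose L : 'Hom('rV['F_2]_r, 'rV['F_2]_#|S|) := linfun (mulmxr B^T).
pose U := lker L.
have inU v : (v \in U) = (v *m B^T == 0) by rewrite memv_ker lfunE.
exists U.
  have := limg_ker_dim L fullv.
  rewrite capfv dimvf /dim /= mul1n -/U => {1}<-; rewrite leq_add2l.
  apply: leq_trans (dimvS (subvf _)) _; rewrite dimvf /dim /= mul1n.
  rewrite -(ler_nat R); apply: le_trans leS (ltW (archi_boundP _)).
  by rewrite divr_ge0 // exprn_ge0 // ltW.
move=> a Aa; rewrite inU; apply/negP => Ka.
pose K (v : 'rV['F_2]_r) : R := (v *m B^T == 0)%:R.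
pose h := \sum_(v : 'rV['F_2]_r) K v.
pose T := \sum_(x in A) \sum_(y in A) \sum_(z in A) K (x + y + z).
pose W := [pred g : 'rV['F_2]_r | (g <= B)%MS].
have hW : #|W|%:R * h = N by exact: card_annihilator.
have W_gt0 : 0 < #|W|%:R :> R.
  by rewrite ltr0n; apply/card_gt0P; exists 0; rewrite inE sub0mx.
have h_gt0 : 0 < h by rewrite -(pmulr_rgt0 _ W_gt0) hW.
(* All cubes sum to 0, so the sum over [W] is minus the sum outside [W]. There [g] is not in [S], so
   minus its cube is at most eps N / 2 times its square, and Parseval applies. *)
have leT : #|W|%:R * T <= eps / 2 * N * (N * #|A|%:R).
  rewrite -sum_hat_cube -hat_parseval.
  have : \sum_g hat R A g ^+ 3 = 0.
    rewrite (eq_bigl (fun g => (g <= (1%:M : 'M['F_2]_r))%MS)) => [|g];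
      last by rewrite submx1.
    rewrite sum_hat_cube [X in _ * X]big1 ?mulr0 // => x Ax.
    rewrite big1 // => y Ay; rewrite big1 // => z Az.
    by rewrite trmx1 mulmx1 (negPf (sfA _ _ _ Ax Ay Az)).
  rewrite (bigID W) /= => /eqP; rewrite addr_eq0 => /eqP ->.
  rewrite mulr_sumr -sumrN [leRHS](bigID W) /= -[leLHS]add0r lerD //.
    apply: sumr_ge0 => g _; rewrite mulr_ge0 ?sqr_ge0 // mulr_ge0 ?ltW //.
    by rewrite divr_gt0.
  apply: ler_sum => g WNg.
  have : g \notin S.
    apply: contra WNg => Sg; rewrite -(enum_rankK_in Sg Sg).
    by rewrite -(rowK (fun i => enum_val i)) row_sub.
  rewrite inE -leNgt => hg.
  by rewrite exprS -mulNr ler_wpM2r ?sqr_ge0 //; lra.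
(* Translation by [a] preserves cosets of H and sends [A] into its complement, since z + (z + a) + a
   = 0. *)
have coset (v : 'rV['F_2]_r) : 2 * \sum_(z in A) K (v + z) <= h.
  rewrite mulr_natl mulr2n /h [leRHS](reindex_inj (addrI v)).
  rewrite [leRHS](bigID (mem A)) lerD2l /= (reindex_inj (addIr a)) big_mkcond
    [leRHS]big_mkcond /=.
  apply: ler_sum => z _.
  have -> : K (v + (z + a)) = K (v + z).
    by rewrite /K addrA mulmxDl (eqP Ka) addr0.
  case: ifP => [Aza|_]; last by case: ifP => // _; rewrite /K ler0n.
  rewrite ifT //; apply/negP => Az; case/negP: (sfA _ _ _ Az Aza Aa).
  exact/eqP/addvvDK_rowF2.
have := sum_coset_pairs coset; rewrite -/K -/h -/T -/N => geT.
(* The density hypothesis bounds the size of [A] minus N/4 below by eps N. Since the size of [W]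
   times [h] is [N], the left side is twice the right side, and both are positive. *)
have : #|W|%:R * (h * #|A|%:R * (eps * N)) <= eps / 2 * N * (N * #|A|%:R).
  apply: le_trans leT; rewrite ler_pM2l //; apply: le_trans geT.
  by rewrite ler_pM2l ?mulr_gt0 //; lra.
rewrite !mulrA hW.
have := mulr_gt0 (mulr_gt0 (mulr_gt0 N_gt0 A_gt0) e_gt0) N_gt0.
by lra.
Qed.

(** * Rank and flats in vector matroids *)

Section VectorRank.
Variables (K : fieldType) (vT : vectType K) (T : finType) (phi : T -> vT).
Implicit Type A : {set T}.

(** A maximal independent subset of [A] spans the image of [A]: a point mapped outside its span
    could be added to it. *)
Lemma rank_of_vector_matroid A :
  rank_of (A : {set vector_matroid phi}) = \dim <<[seq phi x | x in A]>>.
Proof.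
apply/eqP; rewrite eqn_leq; apply/andP; split.
  apply/bigmax_leqP => I /andP[frI /subsetP sIA].
  rewrite cardE -(size_map phi) -(eqP (frI : free [seq phi x | x in I])).
  apply/dimvS/sub_span => _ /imageP[x Ix ->].
  by apply: image_f; apply: sIA.
pose P (I : {set T}) := vector_indep phi I && (I \subset A).
have P0 : P set0 by rewrite /P vector_set0 sub0set.
have [I maxI _] := maxset_exists P0.
have /maxsetP[/andP[frI sIA] Imax] := maxI.
apply: leq_trans (leq_bigmax_cond I _); last by rewrite -/(P I) /P frI.
rewrite cardE -(size_map phi) -(eqP (frI : free [seq phi x | x in I])).
apply/dimvS/span_subvP => _ /imageP[x Ax ->].
have [Ix|I'x] := boolP (x \in I); first by apply/memv_span/image_f.
apply: contraR I'x => Ux; rewrite -(Imax (x |: I)) ?setU11 ?subsetUr //.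
rewrite /P subUset sub1set Ax sIA !andbT.
have I'x : x \notin I by apply: contra Ux => Ix; apply/memv_span/image_f.
rewrite /vector_indep (@perm_free _ _ _ (phi x :: [seq phi y | y in I])).
  by rewrite free_cons Ux.
rewrite -[_ :: _]/(map phi (x :: enum I)); apply: perm_map.
apply: uniq_perm; rewrite /= ?enum_uniq ?mem_enum ?I'x // => y.
by rewrite !inE !mem_enum !inE.
Qed.

End VectorRank.

Section Flat.
Variables (r : nat) (U : {vspace 'rV['F_2]_r}).

Definition subspace_points : {set PG r} := [set v : PG r | val v \in U].

Lemma span_subspace_points : <<[seq val v | v in subspace_points]>>%VS = U.
Proof.
apply/eqP; rewrite eqEsubv; apply/andP; split.
  by apply/span_subvP => _ /imageP[v + ->]; rewrite inE.
apply/subvP => v Uv; have [->|v0] := eqVneq v 0; first exact: mem0v.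
apply: memv_span; apply/imageP.
by exists (exist _ v v0 : PG r); rewrite ?inE.
Qed.

Lemma rank_subspace_points : rank_of subspace_points = \dim U.
Proof. by rewrite rank_of_vector_matroid span_subspace_points. Qed.

Lemma flat_subspace_points : flat subspace_points.
Proof.
apply/forallP => x; apply/implyP; rewrite inE => U'x.
rewrite rank_subspace_points rank_of_vector_matroid.
set V := <<_>>%VS.
have sUV : (U <= V)%VS.
  rewrite -[X in (X <= _)%VS]span_subspace_points; apply: sub_span.
  by move=> _ /imageP[v Fv ->]; apply: image_f; rewrite setU1r.
rewrite ltn_neqAle dimvS // andbT; apply: contra U'x => /eqP eqd.
have /eqP -> : U == V by rewrite eqEdim sUV eqd leqnn.
by apply/memv_span/image_f/setU11.
Qed.

End Flat.

(** * Simple binary matroids as sets of points of a projective geometry *)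

Section SimpleBinary.
Variables (M : matroid) (n : nat) (phi : M -> 'rV['F_2]_n).
Hypothesis simM : simple M.
Hypothesis indep_phi :
  forall A : {set M}, indep M A = indep (vector_matroid phi) A.

Lemma simple_phi_neq0 x : phi x != 0.
Proof.
have /forallP/(_ [set x]) := simM; rewrite cards1 /= indep_phi /= /vector_indep.
by rewrite /image_mem enum_set1 seq1_free.
Qed.

Lemma simple_phi_inj : injective phi.
Proof.
move=> x y; have /forallP/(_ [set x; y]) := simM.
rewrite cards2 (leq_ltn_trans (leq_b1 _)) //= indep_phi.
by move=> /free_uniq/dinjectiveP; apply; rewrite !inE eqxx ?orbT.
Qed.

Lemma rank_binary : rank M = \dim <<[seq phi x | x in [set: M]]>>.
Proof.
rewrite -rank_of_vector_matroid /rank /rank_of; apply: eq_bigl => I.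
by rewrite indep_phi.
Qed.

(** Coordinates in a basis of the span [U] of the representation, whose dimension is the rank of
    [M], give a linear map that is injective on [U] and so preserves independence. *)
Lemma simple_binary_embedding : exists f : {ffun M -> PG (rank M)}, embedding f.
Proof.
set U := <<[seq phi x | x in [set: M]]>>%VS.
have [X basX] : exists X : (rank M).-tuple 'rV['F_2]_n, basis_of U X.
  by rewrite rank_binary; exists (vbasis U); apply: vbasisP.
have phiU x : phi x \in U by apply/memv_span/image_f.
pose g (v : 'rV['F_2]_n) : 'rV['F_2]_(rank M) := \row_i coord X i v.
have g_lin : linear g.
  by move=> a u v; apply/rowP => i; rewrite !mxE linearP.
pose gL := GRing.isLinear.Build _ _ _ _ g g_lin.
pose G : {linear _ -> _} := HB.pack g gL.
pose h := linfun G.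
have hE v : h v = g v by rewrite lfunE.
have ginj v : v \in U -> g v = 0 -> v = 0.
  move=> Uv /rowP gv0; rewrite (coord_basis basX Uv) big1 // => i _.
  by have := gv0 i; rewrite !mxE => ->; rewrite scale0r.
have kerU : (U :&: lker h = 0)%VS.
  apply/eqP; rewrite -subv0; apply/subvP => v.
  by rewrite memv_cap memv_ker hE memv0 => /andP[Uv /eqP/(ginj _ Uv) ->].
have gphi0 x : g (phi x) != 0.
  by apply: contra (simple_phi_neq0 x) => /eqP/(ginj _ (phiU x)) ->.
pose f : {ffun M -> PG (rank M)} := [ffun x => exist _ (g (phi x)) (gphi0 x)].
have fE x : val (f x) = h (phi x) by rewrite ffunE hE.
have f_inj : injective f.
  move=> x y /(congr1 val); rewrite !fE => hxy; apply: simple_phi_inj.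
  have /ginj : g (phi x - phi y) = 0 by rewrite -hE linearB /= hxy subrr.
  by rewrite rpredB // => /(_ isT)/eqP; rewrite subr_eq0 => /eqP.
exists f; apply/andP; split; first exact/injectiveP.
apply/forallP => A; apply/eqP; rewrite indep_phi /= /vector_indep.
rewrite (@perm_free _ _ _ [seq h v | v <- [seq phi x | x in A]]).
  rewrite /free -limg_span limg_dim_eq ?size_map //.
  apply/eqP; rewrite -subv0 -kerU capvS //.
  by apply: sub_span => _ /imageP[x _ ->]; apply: image_f.
rewrite -map_comp -(eq_map fE) (map_comp val); apply: perm_map.
apply: uniq_perm; rewrite ?(map_inj_uniq f_inj) ?enum_uniq // => v.
rewrite mem_enum; apply/imsetP/mapP => -[x Ax ->]; exists x => //.
  by rewrite mem_enum.
by rewrite -mem_enum.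
Qed.

End SimpleBinary.

(** If the sum were 0, two equal terms would force the third to be 0, which is not a point. Three
    distinct terms would be dependent but pairwise independent by simplicity, giving a copy of
    U_{2,3}. *)
Lemma triangle_free_sum_neq0 (M : matroid) r (f : {ffun M -> PG r}) :
  simple M -> embedding f -> triangle_free M ->
  forall a b c, val (f a) + val (f b) + val (f c) != 0.
Proof.
move=> simM /andP[/injectiveP f_inj /forallP indep_f] tfM a b c.
apply/negP => /eqP abc0; apply: tfM.
have neq x y z : val (f x) + val (f y) + val (f z) = 0 -> x != y.
  move=> xyz0; apply/eqP => xy; move: xyz0; rewrite xy addvv_rowF2 add0r.
  by have := valP (f z) => /= /eqP.
have ab := neq _ _ _ abc0.
have bc : b != c by apply: (neq _ _ a); rewrite addrC addrA.
have ac : a != c by apply: (neq _ _ b); rewrite addrAC.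
pose t := [tuple a; b; c].
have t_inj : injective (tnth t).
  by apply/tuple_uniqP; rewrite /= !inE negb_or ab ac bc.
exists [ffun i => tnth t i]; apply/andP; split.
  by apply/injectiveP => i j; rewrite !ffunE => /t_inj.
apply/forallP => A; rewrite [indep _ A]/= /uniform_indep.
have [leA|ltA] := leqP #|A| 2.
  have /forallP/(_ ([ffun i => tnth t i] @: A))/implyP -> // := simM.
  exact: leq_trans (leq_imset_card _ _) leA.
have -> : A = setT by apply/eqP; rewrite eqEcard subsetT cardsT card_ord.
rewrite eqbF_neg -(eqP (indep_f _)); set B := _ @: setT.
have inB x : x \in t -> x \in B.
  by case/tnthP => i ->; apply/imsetP; exists i; rewrite ?inE ?ffunE.
apply/negP => frB.
have := @indep_sub _ (f @: [set a; b; c]) (f @: B) _ frB.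
rewrite imsetS => [/(_ isT)|]; last first.
  by rewrite !subUset !sub1set !inB ?inE ?eqxx ?orbT.
rewrite /= /vector_indep.
rewrite (@perm_free _ _ _ [:: val (f a); val (f b); val (f c)]).
  rewrite free_cons => /andP[/negP + _]; apply.
  have -> : val (f a) = val (f b) + val (f c).
    move: abc0; move: (val (f a)) (val (f b)) (val (f c)) => u v w uvw0.
    rewrite -[RHS]add0r -(addvv_rowF2 u) -addrA [u + (v + w)]addrA.
    by rewrite uvw0 addr0.
  by rewrite memvD // memv_span // !inE eqxx ?orbT.
rewrite -[[:: _; _; _]]/(map val [:: f a; f b; f c]); apply: perm_map.
apply: uniq_perm; rewrite ?enum_uniq //=.
  by rewrite !inE !(inj_eq f_inj) negb_or ab ac bc.
by move=> v; rewrite mem_enum !imsetU !imset_set1 !inE -orbA.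
Qed.

(** * From a disjoint subspace to the critical number *)

Lemma subspace_disjoint_flat (M : matroid) (f : {ffun M -> PG (rank M)})
    (U : {vspace 'rV['F_2]_(rank M)}) :
  embedding f -> (forall x, val (f x) \notin U) ->
  has_disjoint_flat M (rank M - \dim U).
Proof.
move=> embf fU; apply/existsP; exists f; rewrite embf /=.
apply/existsP; exists (subspace_points U); apply/and3P; split.
- exact: flat_subspace_points.
- rewrite rank_subspace_points subnKC //.
  by have := dimvS (subvf U); rewrite dimvf /dim /= mul1n.
- rewrite disjoint_sym; apply/pred0P => v /=; apply/negbTE/negP.
  by move=> /andP[/imsetP[x _ ->]]; rewrite inE (negPf (fU x)).
Qed.

Lemma critical_number_le (M : matroid) (f : {ffun M -> PG (rank M)})
    (U : {vspace 'rV['F_2]_(rank M)}) :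
  embedding f -> (forall x, val (f x) \notin U) ->
  (critical_number M <= rank M - \dim U)%N.
Proof.
move=> embf fU; rewrite /critical_number; case: arg_minnP => /=.
  (* The zero subspace, that is the empty flat, shows that the default [ord_max] is admissible. *)
  have := @subspace_disjoint_flat M f 0%VS embf; rewrite dimv0 subn0; apply.
  by move=> x; rewrite memv0; apply: valP (f x).
move=> c _ minc; have lt : (rank M - \dim U < (rank M).+1)%N.
  by rewrite ltnS leq_subr.
by apply: (minc (Ordinal lt)); apply: subspace_disjoint_flat embf fU.
Qed.

Theorem theorem1p1 (R : realType) (eps : R) :
  0 < eps ->
  exists c : int, forall M : matroid,
    simple M -> binary M -> triangle_free M ->
    (4^-1 + eps) * 2 ^+ rank M <= #|[set: M]|%:R ->
    (critical_number M)%:Z <= c.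
Proof.
(* This bounds the codimension of the subspace found by Fourier analysis, whatever the rank of
   [M]. *)
move=> e_gt0; exists (Num.bound (4 / eps ^+ 2))%:Z.
move=> M simM [n [phi bin]] tfM dM.
have [f embf] := simple_binary_embedding simM bin.
have sumf := triangle_free_sum_neq0 simM embf tfM.
have f_inj : injective (fun x => val (f x)).
  by case/andP: embf => /injectiveP f_inj _ x y /val_inj/f_inj.
pose A := [set val (f x) | x in [set: M]].
have [| |U leU AU] := @sum_free_large_subspace R eps (rank M) A e_gt0.
- by move=> _ _ _ /imsetP[x _ ->] /imsetP[y _ ->] /imsetP[z _ ->].
- by rewrite card_imset.
have /(critical_number_le embf) : forall x, val (f x) \notin U.
  by move=> x; apply: AU; apply: imset_f.
by rewrite lez_nat => /leq_trans; apply; rewrite leq_subLR.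
Qed.
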